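(* Let $t$ be a positive integer and let $G_{t+3}$ be the graph with vertex set $$V(G_{t+3})=\{(i,j): 1\le i<j-1\le t+2,\ (i,j)\ne(1,t+3)\},$$ where $i,j$ are integers, and where two vertices $(i,j)$ and $(k,l)$ are adjacent if and only if they are crossing or separated. Then $\chi(G_{t+3})=t+1$ and the vertex $(2,t+3)$ is critical in $G_{t+3}$.
   Context: The vertices of $G_{t+3}$ are edges of the ordered complete graph on $[t+3]=\{1,\dots,t+3\}$, written as pairs $(i,j)$ with $i<j$. Pairs $(a,b)$ and $(c,d)$ with $a<b$, $c<d$ are crossing if $a<c<b<d$ or $c<a<d<b$; they are separated if $a<b<c<d$ or $c<d<a<b$. (In particular, pairs sharing an element are neither crossing nor separated.) $\chi$ denotes the chromatic number. A vertex of a graph is critical if its removal decreases the chromatic number. *)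

(* Defs.v *)
From mathcomp Require Import all_boot.

Set Implicit Arguments.
Unset Strict Implicit.
Unset Printing Implicit Defensive.

Record sgraph := SGraph {
  svertex :> finType;
  sedge : rel svertex;
  sedge_sym : symmetric sedge;
  sedge_irrefl : irreflexive sedge }.

Definition colorable (G : sgraph) (k : nat) : bool :=
  [exists f : {ffun G -> 'I_k},
     [forall x, forall y, sedge x y ==> (f x != f y)]].

Lemma colorable_ex (G : sgraph) : exists k, colorable G k.
Proof.
exists #|G|; apply/existsP; exists [ffun x => enum_rank x].
apply/forallP=> x; apply/forallP=> y; apply/implyP=> exy.
rewrite !ffunE; apply: contraTneq exy => /enum_rank_inj ->.
by rewrite sedge_irrefl.
Qed.

Definition chi (G : sgraph) : nat := ex_minn (colorable_ex G).

Section VertexRemoval.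
Variables (G : sgraph) (v : G).

Definition del_rel : rel {x : G | x != v} := fun x y => sedge (val x) (val y).

Lemma del_rel_sym : symmetric del_rel.
Proof. by move=> x y; apply: sedge_sym. Qed.

Lemma del_rel_irrefl : irreflexive del_rel.
Proof. by move=> x; apply: sedge_irrefl. Qed.

Definition del_vertex : sgraph := SGraph del_rel_sym del_rel_irrefl.

Definition critical : Prop := chi del_vertex < chi G.
End VertexRemoval.

Definition crossing (p q : nat * nat) : bool :=
  let: (a, b) := p in let: (c, d) := q in
  (a < c < b) && (b < d) || (c < a < d) && (d < b).

Definition separated (p q : nat * nat) : bool :=
  let: (a, b) := p in let: (c, d) := q in
  (a < b < c) && (c < d) || (c < d < a) && (a < b).

Definition is_vertex (n : nat) (p : nat * nat) : bool :=
  let: (i, j) := p in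
  [&& 1 <= i, i < j - 1, j - 1 <= n - 1 & (i, j) != (1, n)].

(* 'I_n.+1 is {0, ..., n}; is_vertex rules out the value 0, so that the
   labels are the actual elements 1, ..., n of [n] and are not shifted. *)
Definition vertex (n : nat) : finType :=
  {p : 'I_n.+1 * 'I_n.+1 | is_vertex n (val p.1, val p.2)}.

Definition ends (n : nat) (v : vertex n) : nat * nat :=
  (val (val v).1, val (val v).2).

Lemma ends_inj (n : nat) : injective (@ends n).
Proof.
move=> u v [E1 E2]; apply: val_inj.
rewrite [val u]surjective_pairing [val v]surjective_pairing.
by congr (_, _); apply: val_inj.
Qed.

Lemma ends_surj (n : nat) (p : nat * nat) :
  is_vertex n p -> exists v : vertex n, ends v = p.
Proof.
case: p => i j Pij; have /and4P[_ lt_ij le_jn _] := Pij.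
have lt_j : j < n.+1.
  have j_gt1 : 0 < j by case: (j) lt_ij.
  case: n le_jn {Pij} => [|n]; rewrite !subn1 /= => le_jn.
    by move: lt_ij; rewrite subn1 (eqP (_ : j.-1 == 0)) // -leqn0.
  by rewrite -(prednK j_gt1) !ltnS.
have lt_i : i < n.+1.
  by apply: ltn_trans lt_j; apply: leq_trans lt_ij (leq_subr _ _).
by exists (Sub (Ordinal lt_i, Ordinal lt_j) Pij).
Qed.

Definition adj (n : nat) : rel (vertex n) :=
  fun u v => crossing (ends u) (ends v) || separated (ends u) (ends v).

Lemma adj_sym (n : nat) : symmetric (@adj n).
Proof.
move=> u v; rewrite /adj; case: (ends u) => a b; case: (ends v) => c d /=.
by congr (_ || _); rewrite orbC.
Qed.

Lemma adj_irrefl (n : nat) : irreflexive (@adj n).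
Proof.
move=> u; rewrite /adj; case: (ends u) => a b /=.
rewrite !ltnn /=; apply/negbTE/negP=> /orP[] /andP[/andP[ab ba] _];
  by move: (ltn_trans ab ba); rewrite ltnn.
Qed.

Definition G (n : nat) : sgraph := SGraph (@adj_sym n) (@adj_irrefl n).

(* Main.v *)
(* A colouring is refuted by Ky Fan's parity argument.  Simplices are lists of
   signed vertices in which every positive vertex is adjacent to every negative
   one, and chains are taken mod 2.  Chains [tower 0], [tower 1], ... are built
   such that the boundary of [tower t.+1] is [tower t] plus its antipode; this
   is possible because the inclusion of G(n) into G(n+1) is null-homotopic:
   three successive moves of the vertices, on alternate signs, bring all
   positive vertices to (n-1, n+1).  Labelling the signed vertices by signed
   colours, the number of simplices of [tower t] whose labels alternate in sign
   when sorted by colour is odd by induction on t, so that some simplex has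
   t+1 distinct colours. *)

Require Import Defs.
From mathcomp Require Import all_boot.
From mathcomp Require Import zify.

Set Implicit Arguments.
Unset Strict Implicit.
Unset Printing Implicit Defensive.

(** * Chains and cochains mod 2, and the prism homotopy *)

Definition parity (T : Type) (phi : seq T -> bool) (C : seq (seq T)) : bool :=
  \big[addb/false]_(s <- C) phi s.

Section Parity.
Variable T : Type.
Implicit Types (phi psi : seq T -> bool) (C : seq (seq T)).

Lemma parity_nil phi : parity phi [::] = false.
Proof. exact: big_nil. Qed.

Lemma parity_cons phi s C : parity phi (s :: C) = phi s (+) parity phi C.
Proof. exact: big_cons. Qed.

Lemma parity_cat phi C1 C2 :
  parity phi (C1 ++ C2) = parity phi C1 (+) parity phi C2.
Proof. exact: big_cat. Qed.

Lemma eq_parity phi psi C : phi =1 psi -> parity phi C = parity psi C.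
Proof. by move=> e; apply: eq_bigr => s _; apply: e. Qed.

Lemma parityD phi psi C :
  parity (fun s => phi s (+) psi s) C = parity phi C (+) parity psi C.
Proof. exact: big_split. Qed.

End Parity.

Lemma parity_map (S T : Type) (h : seq S -> seq T) phi C :
  parity phi (map h C) = parity (phi \o h) C.
Proof. exact: big_map. Qed.

Lemma parity_flatten (S T : Type) (F : seq S -> seq (seq T)) phi C :
  parity phi (flatten (map F C)) = parity (fun s => parity phi (F s)) C.
Proof. by rewrite /parity big_flatten big_map. Qed.

(* The complex is augmented: the only face of a one-element list is empty. *)
Fixpoint faces (T : Type) (s : seq T) : seq (seq T) :=
  if s is x :: s' then s' :: map (cons x) (faces s') else [::].

(** Chains are only tested against cochains: [parity (cobound phi) C] is the value of [phi] on the
    boundary of [C]. *)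
Definition cobound (T : Type) (phi : seq T -> bool) (s : seq T) : bool :=
  parity phi (faces s).

(** The usual prism operator: the simplices [f x_0, ..., f x_i, g x_i, ..., g x_m]. *)
Fixpoint prism (S T : Type) (f g : S -> T) (s : seq S) : seq (seq T) :=
  if s is x :: s' then
    (f x :: g x :: map g s') :: map (cons (f x)) (prism f g s')
  else [::].

Section Coboundary.
Variable T : Type.

Lemma cobound_cons (phi : seq T -> bool) x s :
  cobound phi (x :: s) = phi s (+) cobound (fun u => phi (x :: u)) s.
Proof. by rewrite /cobound /= parity_cons parity_map. Qed.

Lemma eq_cobound (phi psi : seq T -> bool) :
  phi =1 psi -> cobound phi =1 cobound psi.
Proof. by move=> e s; apply: eq_parity. Qed.

Lemma coboundD (phi psi : seq T -> bool) s :
  cobound (fun u => phi u (+) psi u) s = cobound phi s (+) cobound psi s.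
Proof. exact: parityD. Qed.

End Coboundary.

Section Prism.
Variables S T : Type.
Implicit Types f g : S -> T.

Lemma cobound_map f (phi : seq T -> bool) s :
  cobound phi (map f s) = cobound (fun u => phi (map f u)) s.
Proof.
elim: s phi => [|x s IHs] phi //=; first by rewrite /cobound !parity_nil.
by rewrite !cobound_cons IHs.
Qed.

Lemma parity_prism_cons f g (phi : seq T -> bool) x s :
  parity phi (prism f g (x :: s)) = phi (f x :: g x :: map g s)
    (+) parity (fun u => phi (f x :: u)) (prism f g s).
Proof. by rewrite /= parity_cons parity_map. Qed.

(** The chain homotopy formula in dual form. Splitting off the head puts [f x] in front of the later
    simplices, hence the induction over all [phi]. *)
Lemma prism_homotopy f g (phi : seq T -> bool) s :
  parity (cobound phi) (prism f g s)
    (+) cobound (fun u => parity phi (prism f g u)) s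
  = phi (map f s) (+) phi (map g s).
Proof.
elim: s phi => [|x s IHs] phi; first by rewrite /cobound !parity_nil !addbb.
have -> : cobound (fun u => parity phi (prism f g u)) (x :: s) =
    parity phi (prism f g s) (+)
    (cobound (fun u => phi (f x :: g x :: map g u)) s (+)
     cobound (fun u => parity (fun v => phi (f x :: v)) (prism f g u)) s).
  rewrite cobound_cons -coboundD; congr (_ (+) _).
  by apply: eq_cobound => u; apply: parity_prism_cons.
have -> : parity (cobound phi) (prism f g (x :: s)) =
    cobound phi (f x :: g x :: map g s) (+) (parity phi (prism f g s) (+)
      parity (cobound (fun v => phi (f x :: v))) (prism f g s)).
  rewrite parity_prism_cons -parityD; congr (_ (+) _).
  by apply: eq_parity => u; apply: cobound_cons.
move: (IHs (fun v => phi (f x :: v))); rewrite !cobound_cons cobound_map /=.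
move: (parity phi _) (parity _ _) (cobound _ _) (cobound _ _).
by move: (phi _) (phi _) (phi _) => [] [] [] [] [] [] [].
Qed.

End Prism.

Lemma prism_mem (S T : eqType) (f g : S -> T) s r y :
  r \in prism f g s -> y \in r ->
  exists2 x, x \in s & y = f x \/ y = g x.
Proof.
elim: s r => [|x s IHs] r //=; rewrite inE => /orP[/eqP->|/mapP[u us ->]].
  rewrite !inE => /or3P[/eqP->|/eqP->|/mapP[z zs ->]].
  - by exists x; [rewrite mem_head | left].
  - by exists x; [rewrite mem_head | right].
  - by exists z; [rewrite inE zs orbT | right].
rewrite inE => /orP[/eqP->|yu]; first by exists x; [rewrite mem_head | left].
by have [z zs e] := IHs u us yu; exists z; rewrite // inE zs orbT.
Qed.

Lemma prism_size (S T : eqType) (f g : S -> T) s r :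
  r \in prism f g s -> size r = (size s).+1.
Proof.
elim: s r => [|x s IHs] r //=; rewrite inE => /orP[/eqP->|/mapP[u us ->]] /=.
  by rewrite size_map.
by rewrite (IHs u).
Qed.

(** * Alternating sign patterns *)

Lemma cobound_perm (T : eqType) (phi : seq T -> bool) s s' :
  (forall u v, perm_eq u v -> phi u = phi v) ->
  perm_eq s s' -> cobound phi s = cobound phi s'.
Proof.
have cobound_mid x s1 s2 (psi : seq T -> bool) :
    (forall u v, perm_eq u v -> psi u = psi v) ->
    cobound psi (s1 ++ x :: s2) = cobound psi (x :: s1 ++ s2).
  elim: s1 psi => [|y s1 IHs] psi sym //=.
  rewrite cobound_cons IHs => [|u v uv]; last by apply: sym; rewrite perm_cons.
  rewrite !cobound_cons (sym (s1 ++ x :: s2) (x :: s1 ++ s2)).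
    rewrite addbCA; congr (_ (+) (_ (+) _)); apply: eq_cobound => u.
    by apply: sym; rewrite -(cat1s y) -(cat1s x) perm_catCA.
  by rewrite -(cat1s x) perm_catCA.
elim: s s' phi => [|x s IHs] s' phi sym pss'.
  by move: pss'; rewrite perm_sym => /perm_nilP ->.
have xs' : x \in s' by rewrite -(perm_mem pss') mem_head.
case/splitPr: xs' pss' => s1 s2 pss'; rewrite cobound_mid // !cobound_cons.
have pss : perm_eq s (s1 ++ s2).
  rewrite -(perm_cons x); apply: perm_trans pss' _.
  by rewrite -(cat1s x) perm_catCA.
rewrite (sym _ _ pss); congr (_ (+) _); apply: IHs => // u v uv.
by apply: sym; rewrite perm_cons.
Qed.

(* The number x encodes the signed colour with sign [odd x] and colour
   [x./2]. *)
Fixpoint alternating (b : bool) (s : seq nat) : bool :=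
  if s is x :: s' then (odd x == b) && alternating (~~ b) s' else true.

(** In an alternating list of two or more entries only the removal of an end keeps alternation, and
    just one end leaves [b] as first sign. Any other list with an alternating face has one pair of
    equal neighbouring signs, and removing either gives the same pattern. *)
Lemma cobound_alternating b s : s != [::] ->
  cobound (alternating b) s = alternating b s (+) alternating (~~ b) s.
Proof.
elim: s b => [|x s IHs] b // _; rewrite cobound_cons /= negbK.
have -> : cobound (fun u => (odd x == b) && alternating (~~ b) u) s =
    (odd x == b) && cobound (alternating (~~ b)) s.
  case: (odd x == b) => //=; rewrite /cobound /parity big1 //.
case: s IHs => [|y s] IHs; first by rewrite /cobound parity_nil; case: b; case: (odd x).
rewrite IHs // negbK /=.
by case: b; case: (odd x); case: (odd y); case: (alternating _ _); case: (alternating _ _).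
Qed.

Definition fan (b : bool) (s : seq nat) : bool := alternating b (sort leq s).

Lemma fan_perm b s s' : perm_eq s s' -> fan b s = fan b s'.
Proof.
by move=> /(perm_sortP leq_total leq_trans anti_leq) e; rewrite /fan e.
Qed.

Lemma cobound_sorted b s :
  sorted leq s -> cobound (fan b) s = cobound (alternating b) s.
Proof.
move=> srt; apply: eq_big_seq => u; rewrite /fan => us.
suff /(sorted_sort leq_trans)-> : sorted leq u by [].
apply: subseq_sorted srt; first exact: leq_trans.
elim: s u us => [|x s IHs] u //=.
rewrite inE => /orP[/eqP->|/mapP[v vs ->]]; first exact: subseq_cons.
by rewrite eqxx IHs.
Qed.

Lemma cobound_fan b s : s != [::] ->
  cobound (fan b) s = fan b s (+) fan (~~ b) s.
Proof.
move=> s0; rewrite (@cobound_perm _ _ s (sort leq s)); last 2 first.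
- exact: fan_perm.
- by rewrite perm_sym perm_sort.
rewrite cobound_sorted; last exact: sort_sorted leq_total _.
by rewrite cobound_alternating // -size_eq0 size_sort size_eq0.
Qed.

Definition flip (x : nat) : nat := if odd x then x.-1 else x.+1.

Lemma alternating_flip b s :
  alternating b (map flip s) = alternating (~~ b) s.
Proof.
elim: s b => [|x s IHs] b //=; rewrite IHs /flip.
by case: ifP => ox; congr andb; case: b; lia.
Qed.

Definition one_signed (s : seq nat) : Prop :=
  {in s &, forall x y, x./2 = y./2 -> x = y}.

(** [flip] reverses the sign and keeps the colour, so it could disturb the order only of codes of
    one colour, and these are equal by [one_signed]. *)
Lemma fan_flip b s : one_signed s -> fan b (map flip s) = fan (~~ b) s.
Proof.
move=> os; rewrite /fan -alternating_flip; congr alternating.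
have -> : sort leq (map flip s) = sort leq (map flip (sort leq s)).
  apply/(perm_sortP leq_total leq_trans anti_leq).
  by apply: perm_map; rewrite perm_sym perm_sort.
apply: (sorted_sort leq_trans); rewrite sorted_map.
apply: (sub_in_sorted _ (allss _) (sort_sorted leq_total s)) => x y.
rewrite !mem_sort => xs ys; rewrite /relpre /flip /= => lexy.
have [/(os _ _ xs ys)-> //|ne] := eqVneq x./2 y./2.
by case: ifP; case: ifP; lia.
Qed.

Lemma alternating_sorted b s :
  alternating b s -> sorted (fun x y => odd x != odd y) s.
Proof.
case: s => //= x s /andP[/eqP <-].
elim: s x => //= y s IHs x /andP[/eqP oy alt].
rewrite oy; apply/andP; split; first by case: (odd x).
by apply: IHs; rewrite oy.
Qed.

(** Neighbours in the sorted list differ in sign, hence in colour, so the colours strictly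
    increase. *)
Lemma fan_size b s k : one_signed s -> {in s, forall x, x./2 < k} ->
  fan b s -> size s <= k.
Proof.
move=> os bnd alt; rewrite -(size_sort leq s) -(size_map half) -(size_iota 0 k).
apply: uniq_leq_size => [|c /mapP[x]]; last first.
  by rewrite mem_sort mem_iota => /bnd ltxk ->.
apply: (sorted_uniq ltn_trans ltnn); rewrite sorted_map.
have : sorted [rel x y | (x <= y) && (odd x != odd y)] (sort leq s).
  by rewrite sorted_relI (sort_sorted leq_total) (alternating_sorted alt).
apply: sub_in_sorted (allss _) => x y.
rewrite !mem_sort => xs ys /= /andP[lexy neq].
have := os x y xs ys; lia.
Qed.

(** * Signed vertices and the tower of chains *)

Definition chord : Type := (bool * (nat * nat))%type.

Definition compat (n : nat) (x y : chord) : bool :=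
  [&& is_vertex n x.2, is_vertex n y.2 &
      (x.1 != y.1) ==> (crossing x.2 y.2 || separated x.2 y.2)].

Definition simplex (n : nat) (s : seq chord) : Prop :=
  {in s &, forall x y, compat n x y}.

Definition antipode (x : chord) : chord := (~~ x.1, x.2).

(* The moves map G(k + 4) to G(k + 5), where (i, k + 5) is adjacent to (c, d)
   exactly when c < i and d != i.  After move1 a positive vertex either has
   this form or ends at k + 1 or before, which allows move2 to push the upper end
   of all negative vertices ending after k to k + 4; then every negative vertex
   is adjacent to (k + 3, k + 5). *)
Definition move1 (k : nat) (x : chord) : chord :=
  let: (sg, (a, b)) := x in
  if sg then
    if b == k + 4 then (sg, (a, k + 5))
    else if k + 2 <= b then (sg, (b, k + 5)) else x
  else x.

Definition move2 (k : nat) (x : chord) : chord :=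
  let: (sg, (a, b)) := x in
  if sg then move1 k x else if k < b then (sg, (a, k + 4)) else x.

Definition move3 (k : nat) (x : chord) : chord :=
  if x.1 then (true, (k + 3, k + 5)) else move2 k x.

Definition contraction (k : nat) (s : seq chord) : seq (seq chord) :=
  prism id (move1 k) s ++ prism (move1 k) (move2 k) s ++
  prism (move2 k) (move3 k) s ++
  [:: (true, (k + 3, k + 5)) :: map (move3 k) s].

(** [tower 1] is a path from positive to negative [(1, 3)]. It is written out because the first
    contraction already starts from G(4). *)
Fixpoint tower (t : nat) : seq (seq chord) :=
  match t with
  | 0 => [:: [:: (true, (1, 3))]]
  | 1 => [:: [:: (true, (1, 3)); (true, (2, 4))];
             [:: (true, (2, 4)); (false, (1, 3))]]
  | (k.+1 as t').+1 =>
      flatten [seq contraction k s ++ contraction k (map antipode s)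
              | s <- tower t']
  end.

(** The three prism formulas telescope from the identity to [move3], and the boundary of the final
    cone cancels the image of [move3]. *)
Lemma contraction_homotopy k (phi : seq chord -> bool) s :
  parity (cobound phi) (contraction k s)
    (+) cobound (fun u => parity phi (contraction k u)) s = phi s.
Proof.
rewrite /contraction !parity_cat parity_cons parity_nil addbF cobound_cons.
have -> : cobound (fun u => parity phi (contraction k u)) s =
    cobound (fun u => parity phi (prism id (move1 k) u)) s (+)
    (cobound (fun u => parity phi (prism (move1 k) (move2 k) u)) s (+)
    (cobound (fun u => parity phi (prism (move2 k) (move3 k) u)) s (+)
     cobound (fun u => phi ((true, (k + 3, k + 5)) :: map (move3 k) u)) s)).
  rewrite -!coboundD; apply: eq_cobound => u.
  by rewrite /contraction !parity_cat parity_cons parity_nil addbF.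
rewrite cobound_map.
move: (prism_homotopy id (move1 k) phi s).
move: (prism_homotopy (move1 k) (move2 k) phi s).
move: (prism_homotopy (move2 k) (move3 k) phi s).
rewrite map_id.
do 3!move: (parity _ _) (cobound (fun u => parity _ _) _).
do 2!move: (phi _); move: (phi _) (phi _) (cobound _ _).
by do 11!case.
Qed.

Lemma compat_sym n x y : compat n x y = compat n y x.
Proof.
rewrite /compat eq_sym andbCA; congr [&& _, _ & _ ==> _].
by case: x.2 y.2 => [a b] [c d] /=; lia.
Qed.

(** Contiguity of [f] and [g], which makes prisms over simplices simplicial. *)
Definition moves (k : nat) (f g : chord -> chord) : Prop :=
  forall x y, compat (k + 4) x y ->
  [&& compat (k + 5) (f x) (f y), compat (k + 5) (f x) (g y) &
      compat (k + 5) (g x) (g y)].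

Ltac chord_cases :=
  move=> [[] [a b]] [[] [c d]];
  rewrite /compat /move3 /move2 /move1 /= ?xpair_eqE;
  do ?[case: ifP => ? /=]; rewrite ?xpair_eqE; lia.

Lemma moves01 k : moves k id (move1 k).
Proof. rewrite /moves; chord_cases. Qed.

Lemma moves12 k : moves k (move1 k) (move2 k).
Proof. rewrite /moves; chord_cases. Qed.

Lemma moves23 k : moves k (move2 k) (move3 k).
Proof. rewrite /moves; chord_cases. Qed.

(** A moved negative vertex either ends at [k] or before and is separated from the apex, or ends at
    [k + 4] and crosses it. *)
Lemma move3_apex k x : compat (k + 4) x x ->
  compat (k + 5) (true, (k + 3, k + 5)) (move3 k x).
Proof.
case: x => [[] [a b]]; rewrite /compat /move3 /move2 /move1 /= ?xpair_eqE;
  do ?[case: ifP => ? /=]; rewrite ?xpair_eqE; lia.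
Qed.

Lemma simplex_prism k f g s r :
  moves k f g -> simplex (k + 4) s -> r \in prism f g s -> simplex (k + 5) r.
Proof.
move=> fg Ss rs u v /(prism_mem rs)[x xs eu] /(prism_mem rs)[y ys ev].
have /and3P[ff fg_xy gg] := fg x y (Ss x y xs ys).
have /and3P[_ fg_yx _] := fg y x (Ss y x ys xs).
by case: eu ev => -> [] ->; rewrite // compat_sym.
Qed.

Lemma simplex_contraction k s r : simplex (k + 4) s ->
  r \in contraction k s -> simplex (k + 5) r /\ size r = (size s).+1.
Proof.
move=> Ss; rewrite /contraction !mem_cat inE.
case/or4P=> [rs|rs|rs|/eqP->].
- by rewrite (prism_size rs); split=> //; apply: simplex_prism (@moves01 k) Ss rs.
- by rewrite (prism_size rs); split=> //; apply: simplex_prism (@moves12 k) Ss rs.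
- by rewrite (prism_size rs); split=> //; apply: simplex_prism (@moves23 k) Ss rs.
rewrite /= size_map; split=> // u v; rewrite !inE.
case/orP=> [/eqP->|/mapP[x xs ->]]; case/orP=> [/eqP->|/mapP[y ys ->]].
- by rewrite /compat /= !xpair_eqE; lia.
- exact: move3_apex (Ss y y ys ys).
- by rewrite compat_sym; apply: move3_apex (Ss x x xs xs).
by have /and3P[_ _] := @moves23 k x y (Ss x y xs ys).
Qed.

Lemma simplex_antipode n s : simplex n s -> simplex n (map antipode s).
Proof.
move=> Ss u v /mapP[x xs ->] /mapP[y ys ->]; have := Ss x y xs ys.
by rewrite /compat /= (inj_eq negb_inj).
Qed.

(* (1, 3) is a vertex of G(4) but not of G(3), hence the maximum. *)
Lemma tower_simplex t s :
  s \in tower t -> simplex (maxn 1 t + 3) s /\ size s = t.+1.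
Proof.
elim: t s => [|[|k] IHk] s.
- by rewrite inE => /eqP->; split=> // u v; rewrite !inE => /eqP-> /eqP->.
- rewrite !inE => /orP[] /eqP->; split=> // u v; rewrite !inE;
    by move=> /orP[] /eqP-> /orP[] /eqP->.
rewrite (_ : maxn 1 k.+2 + 3 = k + 5); last lia.
rewrite (_ : maxn 1 k.+1 + 3 = k + 4) in IHk; last lia.
case/flattenP=> C /mapP[u /IHk[Su zu] ->]; rewrite mem_cat -zu.
case/orP=> su; first exact: simplex_contraction Su su.
rewrite -(size_map antipode u); apply: (simplex_contraction (simplex_antipode Su) su).
Qed.

Lemma antipodeK : involutive antipode.
Proof. by case=> sg p; rewrite /antipode /= negbK. Qed.

(** The error term contracts the boundary of [tower k.+1] and its antipode. By induction that
    boundary is antipodally symmetric, so the error occurs twice and vanishes. *)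
Lemma tower_boundary t (phi : seq chord -> bool) :
  parity (cobound phi) (tower t.+1) =
  parity phi (tower t) (+) parity (phi \o map antipode) (tower t).
Proof.
elim: t phi => [|k IHk] phi.
  rewrite /= !parity_cons !parity_nil /cobound /= !parity_cons !parity_nil.
  rewrite /antipode /=.
  by do 3!case: (phi _).
pose psi s := parity phi (contraction k s).
pose dpsi s := cobound psi s (+) cobound psi (map antipode s).
rewrite (_ : tower k.+2 = flatten
  [seq contraction k s ++ contraction k (map antipode s) | s <- tower k.+1]) //.
rewrite parity_flatten.
have -> : parity (fun s => parity (cobound phi)
      (contraction k s ++ contraction k (map antipode s))) (tower k.+1) =
    parity phi (tower k.+1) (+) parity (phi \o map antipode) (tower k.+1) (+)
    parity dpsi (tower k.+1).
  rewrite -!parityD; apply: eq_parity => s; rewrite parity_cat /dpsi /=.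
  rewrite -(contraction_homotopy k phi s).
  rewrite -(contraction_homotopy k phi (map antipode s)).
  by rewrite [in RHS]addbACA !addbK.
have -> : parity dpsi (tower k.+1) =
    parity (cobound (fun s => psi s (+) psi (map antipode s))) (tower k.+1).
  by apply: eq_parity => s; rewrite /dpsi cobound_map coboundD.
rewrite IHk [X in _ (+) X](_ : _ = false) ?addbF //.
rewrite -parityD /parity big1 // => s _ /=.
by rewrite (mapK antipodeK) [X in _ (+) X]addbC addbb.
Qed.

(** * The lower bound on the number of colours *)

Section Coloring.
Variables (t : nat) (color : nat * nat -> nat).
Hypothesis t_gt0 : 0 < t.
Hypothesis color_proper : forall p q,
  is_vertex (t + 3) p -> is_vertex (t + 3) q ->
  crossing p q || separated p q -> color p != color q.

Definition label (x : chord) : nat := (color x.2).*2 + x.1.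

Lemma odd_label x : odd (label x) = x.1.
Proof. by rewrite /label oddD odd_double; case: x.1. Qed.

Lemma half_label x : (label x)./2 = color x.2.
Proof. by rewrite /label addnC half_bit_double. Qed.

Lemma label_antipode x : label (antipode x) = flip (label x).
Proof. by rewrite /flip odd_label /label /=; case: x.1 => /=; lia. Qed.

Lemma is_vertexS n m p : n <= m -> is_vertex n p -> is_vertex m p.
Proof. by case: p => a b /=; rewrite !xpair_eqE; lia. Qed.

Lemma one_signed_label n s :
  n <= t + 3 -> simplex n s -> one_signed (map label s).
Proof.
move=> le_n Ss u v /mapP[x xs ->] /mapP[y ys ->]; rewrite !half_label => e.
have /and3P[/(is_vertexS le_n) Vx /(is_vertexS le_n) Vy /implyP adj_xy] :=
  Ss x y xs ys.
have [e1|/adj_xy /(color_proper Vx Vy)] := eqVneq x.1 y.1.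
  by rewrite /label e e1.
by rewrite e eqxx.
Qed.

(** The sum on [tower k.+1] is [fan true] on its boundary, that is, on [tower k] and on its
    antipode, where [flip] turns it into [fan false] on [tower k]. *)
Lemma fan_tower k : k <= t ->
  parity (fun s => fan true (map label s) (+) fan false (map label s)) (tower k).
Proof.
elim: k => [|k IHk] le_kt.
  by rewrite /= parity_cons parity_nil /fan /= odd_label.
have -> : parity (fun s => fan true (map label s) (+) fan false (map label s))
    (tower k.+1) =
    parity (cobound (fun s => fan true (map label s))) (tower k.+1).
  apply: eq_big_seq => s /tower_simplex[_ size_s].
  by rewrite -cobound_map cobound_fan // -size_eq0 size_map size_s.
rewrite tower_boundary -parityD.
suff -> : parity (fun s => fan true (map label s) (+)
      ((fun u => fan true (map label u)) \o map antipode) s) (tower k) =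
    parity (fun s => fan true (map label s) (+) fan false (map label s))
      (tower k) by apply: IHk; lia.
apply: eq_big_seq => s /tower_simplex[Ss _] /=; congr (_ (+) _).
rewrite -map_comp (eq_map (g := flip \o label)); last exact: label_antipode.
rewrite map_comp fan_flip //; apply: one_signed_label Ss; lia.
Qed.

Lemma color_bound k :
  (forall p, is_vertex (t + 3) p -> color p < k) -> t < k.
Proof.
move=> bnd; case: (ltnP t k) => // le_kt.
(* With [k <= t] colours no simplex of [t + 1] entries alternates, so the parity would be even. *)
have := fan_tower (leqnn t); rewrite /parity big1_seq // => s /andP[_].
case/tower_simplex; rewrite (maxn_idPr t_gt0) => Ss size_s.
have fanF b : fan b (map label s) = false.
  apply/negbTE/negP => /(@fan_size _ _ k).
  rewrite size_map size_s => lt_tk; suff: t < k by lia.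
  apply: lt_tk; first exact: one_signed_label (leqnn _) Ss.
  move=> c /mapP[x xs ->]; rewrite half_label; apply: bnd.
  by have /and3P[] := Ss x x xs xs.
by rewrite !fanF.
Qed.

End Coloring.

Lemma chi_lower t : 0 < t -> t + 1 <= chi (G (t + 3)).
Proof.
move=> t_gt0; rewrite /chi; case: ex_minnP => k /existsP[f /forallP fP] _.
pose color p : nat :=
  if [pick v : G (t + 3) | ends v == p] is Some v then f v else 0.
have colorE (v : G (t + 3)) : color (ends v) = f v.
  rewrite /color; case: pickP => [u /eqP/ends_inj -> //|/(_ v)].
  by rewrite eqxx.
rewrite addn1; apply: (@color_bound t color t_gt0) => [p q|p].
  move=> /ends_surj[u <-] /ends_surj[v <-] uv; rewrite !colorE.
  by have /forallP/(_ v)/implyP/(_ uv) := fP u.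
by move=> /ends_surj[u <-]; rewrite colorE.
Qed.

(** * The upper bound and criticality *)

Lemma chi_leq (H : sgraph) k (f : H -> nat) :
  (forall x, f x < k) -> (forall x y : H, sedge x y -> f x != f y) ->
  chi H <= k.
Proof.
move=> bnd fP; rewrite /chi; case: ex_minnP => m _; apply.
apply/existsP; exists [ffun x => Ordinal (bnd x)].
apply/forallP => x; apply/forallP => y; apply/implyP => /fP.
by rewrite !ffunE.
Qed.

(* Stars at 3, ..., t + 2; the value t is taken only by (2, t + 3). *)
Definition star_color (p : nat * nat) : nat :=
  if 3 <= p.1 then p.1 - 3 else p.2 - 3.

(** Two vertices of colour [c] share the element [c + 3]. *)
Lemma star_color_proper n (u v : G n) :
  sedge u v -> star_color (ends u) != star_color (ends v).
Proof.
rewrite /= /adj.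
have : is_vertex n (ends u) by apply: (valP u).
have : is_vertex n (ends v) by apply: (valP v).
rewrite /star_color; case: (ends u) (ends v) => [a b] [c d] /=.
by rewrite !xpair_eqE; do 2!case: ifP; lia.
Qed.

(** The Boolean term serves both bounds: [t + 1] colours in all, and [t] once [(2, t + 3)] is
    deleted. *)
Lemma star_color_bound t (v : G (t + 3)) :
  star_color (ends v) < t + (ends v == (2, t + 3)).
Proof.
have : is_vertex (t + 3) (ends v) by apply: (valP v).
rewrite /star_color; case: (ends v) => [a b] /=.
by rewrite !xpair_eqE; case: ifP; lia.
Qed.

Theorem lemma3p7 (t : nat) (t_gt0 : 0 < t) :
  chi (G (t + 3)) = t + 1 /\
  exists v : G (t + 3), ends v = (2, t + 3) /\ critical v.
Proof.
split.
  apply/eqP; rewrite eqn_leq chi_lower // andbT.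
  apply: (@chi_leq _ _ (fun v : G (t + 3) => star_color (ends v))) => [v|].
    by apply: leq_trans (star_color_bound v) _; rewrite leq_add2l leq_b1.
  exact: star_color_proper.
have [|v ev] := @ends_surj (t + 3) (2, t + 3).
  by rewrite /is_vertex xpair_eqE; lia.
exists v; split=> //; rewrite /critical.
apply: leq_trans (chi_lower t_gt0); rewrite addn1 ltnS.
pose f (x : @del_vertex (G (t + 3)) v) := star_color (ends (val x)).
apply: (@chi_leq _ _ f).
  move=> x; have := star_color_bound (val x); rewrite -ev -/(f x).
  by rewrite (inj_eq (@ends_inj _)) (negbTE (valP x)) addn0.
by move=> x y; apply: star_color_proper.
Qed.
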